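(* Let $\mathcal{X}=\mathbb{Z}^d$ or $\mathbb{R}^d$ and let $(\phi_x)_{x\in\mathcal{X}}$ be a non-singular measurable flow on a $\sigma$-finite measure space $(S,\mathcal{B},\mu)$. There is a decomposition of $S$ into two disjoint measurable sets $S=N_0\cup N_+$ such that (i) $N_0$ and $N_+$ are $(\phi_x)_{x\in\mathcal{X}}$-invariant modulo null sets; (ii) for every non-negative $g\in L^1(S,\mu)$ supported on $N_0$, $\lim_{x\to\infty}\int_S(U_xg\wedge g)\,\mathrm{d}\mu=0$; (iii) for every non-negative $h\in L^1(S,\mu)$ supported on $N_+$ and not vanishing identically, $\limsup_{x\to\infty}\int_S(U_xh\wedge h)\,\mathrm{d}\mu>0$. Properties (ii) and (iii) determine $N_0$ and $N_+$ uniquely modulo null sets.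
   Context: A measurable non-singular flow: maps $\phi_x:S\to S$ with $\phi_0=\mathrm{id}$, $\phi_{x_1+x_2}=\phi_{x_2}\circ\phi_{x_1}$, $(x,s)\mapsto\phi_x(s)$ jointly measurable, and $\mu\circ\phi_x^{-1}$ equivalent to $\mu$ for every $x$. $\omega_x=\frac{\mathrm{d}(\mu\circ\phi_x)}{\mathrm{d}\mu}$, and $(U_xg)(s)=\omega_x(s)g(\phi_x(s))$ for $g\in L^1(S,\mu)$. $x\to\infty$ means $|x|\to\infty$. *)

(* Defs.v *)
From HB Require Import structures.
From mathcomp Require Import all_boot all_order all_algebra.
From mathcomp Require Import all_classical all_reals all_analysis.
Set Implicit Arguments. Unset Strict Implicit. Unset Printing Implicit Defensive.
Import Order.TTheory GRing.Theory Num.Theory.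
Import numFieldNormedType.Exports.
Local Open Scope classical_set_scope.
Local Open Scope ring_scope.

(* Vectors of R^d are represented as row vectors 'rV[R]_d (for the group law
   and the norm); for measurability R^d is identified with d.-tuple R, which
   carries the product (= Borel) sigma-algebra of MathComp-Analysis. *)
Definition row_of_tuple (R : realType) (d : nat) (t : d.-tuple R) : 'rV[R]_d :=
  \row_(i < d) tnth t i.

Definition Zlattice (R : realType) (d : nat) : set 'rV[R]_d :=
  [set x | forall i : 'I_d, x ord0 i \is a Num.int].

Definition index_group (R : realType) (d : nat) (X : set 'rV[R]_d) : Prop :=
  X = @Zlattice R d \/ X = setT.

Definition nonsingular_flow (R : realType) (d : nat) (X : set 'rV[R]_d)
    (dT : measure_display) (T : measurableType dT)
    (mu : {measure set T -> \bar R}) (phi : 'rV[R]_d -> T -> T) : Prop :=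
  [/\ phi 0 = id,
      (forall x1 x2, X x1 -> X x2 -> phi (x1 + x2) = phi x2 \o phi x1),
      measurable_fun ([set t : d.-tuple R | X (row_of_tuple t)] `*` [set: T])
        (fun p : d.-tuple R * T => phi (row_of_tuple p.1) p.2)
    & (forall x A, X x -> measurable A ->
         (mu (phi x @^-1` A) = 0%E <-> mu A = 0%E))].

Definition is_RN_cocycle (R : realType) (d : nat) (X : set 'rV[R]_d)
    (dT : measure_display) (T : measurableType dT)
    (mu : {measure set T -> \bar R}) (phi : 'rV[R]_d -> T -> T)
    (omega : 'rV[R]_d -> T -> R) : Prop :=
  forall x, X x ->
    [/\ measurable_fun [set: T] (omega x),
        (forall s, 0 <= omega x s)
      & (forall A, measurable A ->
           mu (phi x @` A) = (\int[mu]_(s in A) (omega x s)%:E)%E)].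

Definition Uop (R : realType) (d : nat) (T : Type)
    (phi : 'rV[R]_d -> T -> T) (omega : 'rV[R]_d -> T -> R)
    (x : 'rV[R]_d) (g : T -> R) : T -> R :=
  fun s => omega x s * g (phi x s).

Definition symdiff (T : Type) (A B : set T) : set T := (A `\` B) `|` (B `\` A).

Definition overlap (R : realType) (d : nat)
    (dT : measure_display) (T : measurableType dT)
    (mu : {measure set T -> \bar R}) (phi : 'rV[R]_d -> T -> T)
    (omega : 'rV[R]_d -> T -> R) (x : 'rV[R]_d) (g : T -> R) : \bar R :=
  (\int[mu]_(s in [set: T]) (Num.min (Uop phi omega x g s) (g s))%:E)%E.

Definition nonneg_L1_on (R : realType)
    (dT : measure_display) (T : measurableType dT)
    (mu : {measure set T -> \bar R}) (N : set T) (g : T -> R) : Prop :=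
  [/\ measurable_fun [set: T] g, mu.-integrable [set: T] (EFin \o g),
      (forall s, 0 <= g s) & (forall s, ~ N s -> g s = 0)].

Definition vanishing_part (R : realType) (d : nat) (X : set 'rV[R]_d)
    (dT : measure_display) (T : measurableType dT)
    (mu : {measure set T -> \bar R}) (phi : 'rV[R]_d -> T -> T)
    (omega : 'rV[R]_d -> T -> R) (N0 : set T) : Prop :=
  forall g, nonneg_L1_on mu N0 g ->
    forall eps : R, 0 < eps -> exists M : R, forall x, X x -> M < `|x| ->
      (overlap mu phi omega x g <= eps%:E)%E.

Definition positive_part (R : realType) (d : nat) (X : set 'rV[R]_d)
    (dT : measure_display) (T : measurableType dT)
    (mu : {measure set T -> \bar R}) (phi : 'rV[R]_d -> T -> T)
    (omega : 'rV[R]_d -> T -> R) (Np : set T) : Prop :=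
  forall h, nonneg_L1_on mu Np h -> mu [set s | h s != 0] <> 0%E ->
    exists2 delta : R, 0 < delta & forall M : R, exists x, [/\ X x, M < `|x| &
      (delta%:E < overlap mu phi omega x h)%E].

Definition is_decomposition (dT : measure_display) (T : measurableType dT)
    (N0 Np : set T) : Prop :=
  [/\ measurable N0, measurable Np, N0 `&` Np = set0 & N0 `|` Np = setT].

(* Main.v *)
(** Write x /\ y for the pointwise minimum and say that g >= 0 in L^1 vanishes
    if the integral of U_x g /\ g tends to 0.  The key point is that then the
    integral of U_x g /\ h tends to 0 for every h >= 0 in L^1: the functions
    U_x g /\ h with widely separated x have small pairwise minima, so only
    finitely many of them with integral above a given level fit below h.  Hence
    the vanishing functions are closed under sums; they are also closed under
    smaller functions, monotone limits and every U_y.  Below a strictly positive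
    f in L^1 there is a vanishing g of maximal integral, and N_0 = {g > 0}
    supports every vanishing function up to null sets. *)
Require Import Defs.
From HB Require Import structures.
From mathcomp Require Import all_boot all_order all_algebra.
From mathcomp Require Import all_classical all_reals all_analysis.
From mathcomp Require Import measurable_realfun ring lra.
Import Order.TTheory GRing.Theory Num.Theory.
Import numFieldNormedType.Exports.
Local Open Scope classical_set_scope.
Local Open Scope ring_scope.

(** * Inequalities for pointwise minima *)

Lemma min_addr_le (R : realFieldType) (a b c : R) :
  0 <= a -> 0 <= b -> 0 <= c ->
  Num.min a (b + c) <= Num.min a b + Num.min a c.
Proof.
move=> a0 b0 c0.
by case: (leP a (b + c)) => ?; case: (leP a b) => ?; case: (leP a c) => ?; lra.
Qed.

(** Split [c] into [c - min b c] and [min b c]: the minimum with [a] is subadditive, and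
    [min a (min b c) <= min a b]. Removing from [c] its part below [b] thus costs only the overlap
    of [a] with [b]. *)
Lemma min_subr_le (R : realFieldType) (a b c : R) :
  0 <= a -> 0 <= b -> 0 <= c ->
  Num.min a c <= Num.min a (c - Num.min b c) + Num.min a b.
Proof.
move=> a0 b0 c0.
by case: (leP b c) => bc; case: (leP a c) => ?; case: (leP a b) => ?;
  case: (leP a (c - _)) => ?; lra.
Qed.

Lemma min_addrl_le (R : realFieldType) (a b c d : R) :
  0 <= c -> 0 <= d -> Num.min (a + c) (b + d) <= Num.min a b + (c + d).
Proof.
by move=> c0 d0; case: (leP a b) => ?; case: (leP (a + c) (b + d)) => ?; lra.
Qed.

Lemma min_addDD_le (R : realFieldType) (a b c d : R) :
  0 <= a -> 0 <= b -> 0 <= c -> 0 <= d ->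
  Num.min (a + b) (c + d) <=
    Num.min a c + Num.min a d + (Num.min b c + Num.min b d).
Proof.
move=> a0 b0 c0 d0; rewrite minC.
apply: le_trans (min_addr_le _ _ _ _ _ a0 b0) _; first by rewrite addr_ge0.
by rewrite ![Num.min (c + d) _]minC lerD// min_addr_le.
Qed.

(** * Set algebra and measurability of the index group *)

Lemma symdiff_setC (T : Type) (A B : set T) :
  symdiff (~` A) (~` B) = symdiff A B.
Proof.
by rewrite /symdiff !setDE !setCK setUC; congr (_ `|` _); exact: setIC.
Qed.

Lemma is_decompositionC (dT : measure_display) (T : measurableType dT)
  (A B : set T) : is_decomposition A B -> B = ~` A.
Proof.
move=> [_ _ AB0 ABT]; apply/seteqP; split=> s ABs.
  by move=> As; have : (A `&` B) s by []; rewrite AB0.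
by have [|] : (A `|` B) s by rewrite ABT.
Qed.

(** Composing with the jointly measurable flow needs a measurable domain. The lattice is a finite
    intersection, over the coordinates, of countable unions of fibres. *)
Lemma measurable_index_group (R : realType) (d : nat) (X : set 'rV[R]_d) :
  index_group X -> measurable [set t : d.-tuple R | X (row_of_tuple t)].
Proof.
case=> ->; last exact: measurableT.
rewrite (_ : mkset _ = \bigcap_(i in [set: 'I_d]) \bigcup_(m in [set: int])
  ((fun t : d.-tuple R => tnth t i) @^-1` [set m%:~R])); last first.
  apply/seteqP; split=> [t /= Xt i _|t /= Xt i].
    by have := Xt i; rewrite /row_of_tuple mxE => /intrP[m tm]; exists m.
  by have [m _ /= tm] := Xt i I; rewrite mxE tm intr_int.
apply: fin_bigcap_measurable => // i _.
apply: countable_bigcupT_measurable => [|m]; first exact: countableP.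
by rewrite -[X in measurable X]setTI; exact: measurable_tnth.
Qed.

(** * Integration against a density *)

Import HBNNSimple.

(** On indicators this is the assumption on [nu]; linearity extends it to simple functions and
    monotone convergence to [f]. *)
Lemma ge0_integral_density (R : realType) (dT : measure_display)
    (T : measurableType dT) (mu nu : {measure set T -> \bar R}) (w f : T -> R) :
  measurable_fun setT w -> (forall s, 0 <= w s) ->
  (forall A, measurable A -> nu A = \int[mu]_(s in A) (w s)%:E)%E ->
  measurable_fun setT f -> (forall s, 0 <= f s) ->
  (\int[mu]_s (w s * f s)%:E = \int[nu]_s (f s)%:E)%E.
Proof.
move=> mw w0 nuE mf f0.
have mEf : measurable_fun setT (EFin \o f) by exact/measurable_EFinP.
have f0' s : setT s -> (0 <= (EFin \o f) s)%E by rewrite lee_fin.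
pose h := nnsfun_approx measurableT mEf.
have hE s : (f s)%:E = limn (fun n => (h n s)%:E).
  apply/esym/cvg_lim => //.
  exact: (cvg_nnsfun_approx measurableT mEf f0').
have wE s : (w s * f s)%:E = limn (fun n => (w s * h n s)%:E).
  apply/esym/cvg_lim => //.
  under eq_fun do rewrite EFinM.
  rewrite EFinM; apply: cvgeZl => //.
  exact: (cvg_nnsfun_approx measurableT mEf f0').
have ndh s m n : (m <= n)%N -> h m s <= h n s.
  by move=> mn; exact/lefP/nd_nnsfun_approx.
under eq_integral do rewrite wE.
under [RHS]eq_integral do rewrite hE.
rewrite monotone_convergence//; last 3 first.
- by move=> n; apply/measurable_EFinP/measurable_funM.
- by move=> n s _; rewrite lee_fin mulr_ge0.
- by move=> s _ m n mn; rewrite lee_fin ler_wpM2l// ndh.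
rewrite [RHS]monotone_convergence//; last 3 first.
- by move=> n; exact/measurable_EFinP.
- by move=> n s _; rewrite lee_fin.
- by move=> s _ m n mn; rewrite lee_fin ndh.
(* From here on [h] is a single simple function, expanded over its finitely many values. *)
congr (limn _); apply/funext => n {hE wE ndh}; move: (h n) => {h}h.
under [RHS]eq_integral do rewrite fimfunE -fsumEFin//.
rewrite [RHS]ge0_integral_fsum//; last 2 first.
- by move=> r; exact/measurable_EFinP/measurable_funM.
- by move=> r s _; exact: nnfun_muleindic_ge0.
under [LHS]eq_integral => s _.
  rewrite EFinM fimfunE -fsumEFin// ge0_mule_fsumr//; last first.
    by move=> r; exact: nnfun_muleindic_ge0.
  over.
rewrite /= ge0_integral_fsum//; last 2 first.
- move=> r; apply: emeasurable_funM; apply/measurable_EFinP => //.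
  exact: measurable_funM.
- by move=> r s _; rewrite mule_ge0 ?lee_fin ?w0//; exact: nnfun_muleindic_ge0.
apply: eq_fsbigr => r; rewrite inE => -[t _ rE].
have r0 : 0 <= r by rewrite -rE.
under [RHS]eq_integral do rewrite EFinM.
rewrite [RHS]ge0_integralZl//; last first.
  exact/measurable_EFinP.
rewrite integral_indic// setIT nuE//.
under eq_integral do rewrite EFinM muleCA.
rewrite ge0_integralZl//; last 2 first.
- by apply: emeasurable_funM; apply/measurable_EFinP.
- by move=> s _; rewrite mule_ge0// lee_fin.
congr (_ * _)%E; rewrite [RHS]integral_mkcond; apply: eq_integral => s _.
by rewrite epatch_indic.
Qed.

(** * Integrals of non-negative functions and of minima *)

Section measure.
Context (R : realType) (dT : measure_display) (T : measurableType dT).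
Context (mu : {measure set T -> \bar R}).
Implicit Types f g h : T -> R.

Lemma ge0_EFin_integralD f g : measurable_fun setT f -> (forall s, 0 <= f s) ->
  measurable_fun setT g -> (forall s, 0 <= g s) ->
  (\int[mu]_s (f s + g s)%:E = \int[mu]_s (f s)%:E + \int[mu]_s (g s)%:E)%E.
Proof.
move=> mf f0 mg g0; under eq_integral do rewrite EFinD.
by rewrite ge0_integralD//; [move=> s _; rewrite lee_fin|exact/measurable_EFinP
  |move=> s _; rewrite lee_fin|exact/measurable_EFinP].
Qed.

Lemma ge0_EFin_le_integral f g :
  measurable_fun setT f -> (forall s, 0 <= f s) ->
  measurable_fun setT g -> (forall s, f s <= g s) ->
  (\int[mu]_s (f s)%:E <= \int[mu]_s (g s)%:E)%E.
Proof.
move=> mf f0 mg fg; apply: ge0_le_integral => //.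
- by move=> s _; rewrite lee_fin.
- exact/measurable_EFinP.
- exact/measurable_EFinP.
- by move=> s _; rewrite lee_fin.
Qed.

Lemma integral_min_le f g A : measurable A ->
  measurable_fun setT f -> (forall s, 0 <= f s) ->
  measurable_fun setT g -> (forall s, 0 <= g s) ->
  (\int[mu]_s (Num.min (f s) (g s))%:E <=
   \int[mu]_(s in A) (f s)%:E + \int[mu]_(s in ~` A) (g s)%:E)%E.
Proof.
move=> mA mf f0 mg g0; have mCA := measurableC mA.
have mm : measurable_fun setT (fun s => Num.min (f s) (g s)).
  exact: measurable_minr.
have m0 s : 0 <= Num.min (f s) (g s) by rewrite le_min f0 g0.
rewrite -{1}(setUv A) ge0_integral_setU//; last 3 first.
- by apply/measurable_EFinP; exact: measurable_funTS.
- by move=> s _; rewrite lee_fin.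
- by rewrite disj_set2E setICr.
apply: leeD; apply: ge0_le_integral => //.
- by move=> s _; rewrite lee_fin.
- by apply/measurable_EFinP; exact: measurable_funTS.
- by apply/measurable_EFinP; exact: measurable_funTS.
- by move=> s _; rewrite lee_fin ge_min lexx.
- by move=> s _; rewrite lee_fin.
- by apply/measurable_EFinP; exact: measurable_funTS.
- by apply/measurable_EFinP; exact: measurable_funTS.
- by move=> s _; rewrite lee_fin ge_min lexx orbT.
Qed.

Lemma measurable_le_set f g : measurable_fun setT f -> measurable_fun setT g ->
  measurable [set s | f s <= g s].
Proof.
move=> mf mg; have /(_ measurableT [set true]) := measurable_fun_ler mf mg.
by rewrite setTI; apply.
Qed.

Lemma measurable_lt_set f g : measurable_fun setT f -> measurable_fun setT g ->
  measurable [set s | f s < g s].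
Proof.
move=> mf mg; have /(_ measurableT [set true]) := measurable_fun_ltr mf mg.
by rewrite setTI; apply.
Qed.

Lemma integral_minE f g :
  measurable_fun setT f -> (forall s, 0 <= f s) ->
  measurable_fun setT g -> (forall s, 0 <= g s) ->
  (\int[mu]_s (Num.min (f s) (g s))%:E =
   \int[mu]_(s in [set s | (f s <= g s)%R]) (f s)%:E +
   \int[mu]_(s in ~` [set s | (f s <= g s)%R]) (g s)%:E)%E.
Proof.
move=> mf f0 mg g0; set A := [set s | _].
have mA : measurable A by exact: measurable_le_set.
have mCA := measurableC mA.
have mm : measurable_fun setT (fun s => Num.min (f s) (g s)).
  exact: measurable_minr.
have m0 s : 0 <= Num.min (f s) (g s) by rewrite le_min f0 g0.
rewrite -{1}(setUv A) ge0_integral_setU//; last 3 first.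
- by apply/measurable_EFinP; exact: measurable_funTS.
- by move=> s _; rewrite lee_fin.
- by rewrite disj_set2E setICr.
congr (_ + _)%E; apply: eq_integral => s; rewrite inE /A/=.
  by move=> /min_idPl ->.
by move=> /negP; rewrite -ltNge => /ltW/min_idPr ->.
Qed.

(* The integral of a minimum is the infimum of the sums in [integral_min_le], so
   it does not increase when both functions are pulled back along [psi]. Arguing
   with these sums avoids the almost everywhere cocycle identity for [omega]. *)
Lemma integral_min_pullback f g f' g' (psi : T -> T) :
  measurable_fun setT f -> (forall s, 0 <= f s) ->
  measurable_fun setT g -> (forall s, 0 <= g s) ->
  measurable_fun setT f' -> (forall s, 0 <= f' s) ->
  measurable_fun setT g' -> (forall s, 0 <= g' s) ->
  measurable_fun setT psi ->
  (forall A, measurable A ->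
    \int[mu]_(s in psi @^-1` A) (f' s)%:E = \int[mu]_(s in A) (f s)%:E)%E ->
  (forall A, measurable A ->
    \int[mu]_(s in psi @^-1` A) (g' s)%:E = \int[mu]_(s in A) (g s)%:E)%E ->
  (\int[mu]_s (Num.min (f' s) (g' s))%:E <=
   \int[mu]_s (Num.min (f s) (g s))%:E)%E.
Proof.
move=> mf f0 mg g0 mf' f'0 mg' g'0 mpsi ff' gg'.
have mA := measurable_le_set _ _ mf mg.
rewrite (integral_minE f g)// -ff'// -gg'; last exact: measurableC.
rewrite preimage_setC; apply: integral_min_le => //.
by rewrite -[X in measurable X]setTI; exact: mpsi.
Qed.

Lemma ge0_integrable_EFinP f : measurable_fun setT f -> (forall s, 0 <= f s) ->
  mu.-integrable setT (EFin \o f) <-> (\int[mu]_s (f s)%:E < +oo)%E.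
Proof.
move=> mf f0.
have fE : (\int[mu]_s `|(EFin \o f) s| = \int[mu]_s (f s)%:E)%E.
  by apply: eq_integral => s _ /=; rewrite ger0_norm.
split=> [/integrableP[_]|foo]; first by rewrite fE.
by apply/integrableP; split; [exact/measurable_EFinP|rewrite fE].
Qed.

(** * Non-negative integrable functions *)

Definition ge0_integrable g :=
  [/\ measurable_fun setT g, forall s, 0 <= g s
    & (\int[mu]_s (g s)%:E < +oo)%E].

Lemma ge0_integrable_le f g : ge0_integrable g -> measurable_fun setT f ->
  (forall s, 0 <= f s) -> (forall s, f s <= g s) -> ge0_integrable f.
Proof.
move=> [mg g0 goo] mf f0 fg; split=> //.
by apply: le_lt_trans goo; exact: ge0_EFin_le_integral.
Qed.

Lemma ge0_integrableD f g : ge0_integrable f -> ge0_integrable g ->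
  ge0_integrable (fun s => f s + g s).
Proof.
move=> [mf f0 foo] [mg g0 goo]; split=> [|s|].
- exact: measurable_funD.
- by rewrite addr_ge0.
- by rewrite ge0_EFin_integralD// lte_add_pinfty.
Qed.

Lemma ge0_integrableB f g : ge0_integrable f -> measurable_fun setT g ->
  (forall s, 0 <= g s) -> (forall s, g s <= f s) ->
  ge0_integrable (fun s => f s - g s).
Proof.
move=> [mf f0 foo] mg g0 gf; apply: (ge0_integrable_le _ f) => // [|s|s].
- exact: measurable_funB.
- by rewrite subr_ge0.
- by rewrite gerBl.
Qed.

Lemma ge0_integrable_max f g : ge0_integrable f -> ge0_integrable g ->
  ge0_integrable (fun s => Num.max (f s) (g s)).
Proof.
move=> fi gi; have [mf f0 _] := fi; have [mg g0 _] := gi.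
apply: (ge0_integrable_le _ _ (ge0_integrableD _ _ fi gi)) => [|s|s].
- exact: measurable_maxr.
- by rewrite le_max f0.
- by rewrite ge_max lerDl lerDr f0 g0.
Qed.

Lemma ge0_integrable_fineK g : ge0_integrable g ->
  (\int[mu]_s (g s)%:E \is a fin_num)%E.
Proof.
move=> [mg g0 goo]; rewrite ge0_fin_numE//.
by apply: integral_ge0 => s _; rewrite lee_fin.
Qed.

Lemma ge0_integral_eq0 g : measurable_fun setT g -> (forall s, 0 <= g s) ->
  (\int[mu]_s (g s)%:E <= 0)%E -> mu [set s | g s != 0] = 0%E.
Proof.
move=> mg g0 gle0.
have mEg : measurable_fun setT (EFin \o g) by exact/measurable_EFinP.
have : (\int[mu]_s `|(EFin \o g) s|)%E = 0%E.
  apply/eqP; rewrite eq_le; apply/andP; split; last exact: integral_ge0.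
  by under eq_integral do rewrite /= ger0_norm//.
move=> /(ae_eq_integral_abs mu measurableT mEg)[N [mN N0 gN]].
apply: (subset_measure0 _ mN _ N0) => //.
  rewrite -[X in measurable X]setTI.
  by have := emeasurable_neq measurableT mEg 0%E.
by move=> s /= /eqP gs0; apply: gN => /= /(_ I) [].
Qed.

(** Otherwise every integral of [G n] stays more than [e] below that of [g]; by monotone convergence
    the finite integral of [g] would be at most itself minus [e]. *)
Lemma ge0_integral_nondecreasing_lim (G : nat -> T -> R) g (e : R) :
  (forall n, measurable_fun setT (G n)) -> (forall n s, 0 <= G n s) ->
  (forall s m n, (m <= n)%N -> G m s <= G n s) ->
  (forall s, G ^~ s @ \oo --> g s) -> ge0_integrable g -> 0 < e ->
  exists n, (\int[mu]_s (g s)%:E <= \int[mu]_s (G n s)%:E + e%:E)%E.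
Proof.
move=> mG G0 ndG Gg gi e0; apply: contrapT => /forallNP noN.
have fing := ge0_integrable_fineK _ gi.
have : (\int[mu]_s (g s)%:E <= \int[mu]_s (g s)%:E - e%:E)%E.
  have gE s : (g s)%:E = limn (fun n => (G n s)%:E).
    by apply/esym/cvg_lim => //; apply: cvg_EFin (Gg s); exact: nearW.
  under [leLHS]eq_integral do rewrite gE.
  have mEG n : measurable_fun setT (fun s => (G n s)%:E).
    exact/measurable_EFinP.
  have G0' n s : setT s -> (0 <= (G n s)%:E)%E by rewrite lee_fin.
  have ndG' s : setT s ->
      {homo (fun n => (G n s)%:E) : m n / (m <= n)%N >-> (m <= n)%E}.
    by move=> _ m n mn; rewrite lee_fin; exact: ndG.
  have cv := @cvg_monotone_convergence _ _ _ mu _ measurableT _ mEG G0' ndG'.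
  rewrite -(cvg_lim _ cv)//; apply: lime_le; first exact: cvgP cv.
  apply: nearW => n; rewrite leeBrDr//.
  by apply/ltW; rewrite ltNge; apply/negP; exact: noN.
rewrite leeBrDr// -[leRHS]adde0 leeD2lE// lee_fin => /le_lt_trans/(_ e0).
by rewrite ltxx.
Qed.

(** Sum multiples of the indicators of the covering sets [F n], with weights small enough for the
    sum to be finite at every point and to have finite integral. *)
Lemma exists_positive_integrable :
  sigma_finite setT mu ->
  exists2 f, ge0_integrable f & forall s, 0 < f s.
Proof.
move=> [F FT /all_and2[mF Foo]].
(* Both [c n] and [c n * mu (F n)] are at most [1 / 2 ^ n.+1], so the series and its integral are
   bounded by 1; the [1 +] keeps the denominator positive. *)
pose c n : R := 1 / (2 ^ n.+1)%:R / (1 + fine (mu (F n))).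
have m0 n : 0 <= fine (mu (F n)) by exact: fine_ge0.
have m1 n : 0 < 1 + fine (mu (F n)) by rewrite ltr_pwDl.
have p0 n : 0 < 1 / (2 ^ n.+1)%:R :> R.
  by rewrite divr_gt0// ltr0n expn_gt0.
have c0 n : 0 < c n by exact: divr_gt0.
have c1 n : c n <= 1 / (2 ^ n.+1)%:R.
  by rewrite /c ler_pdivrMr// ler_peMr ?(ltW (p0 n))// lerDl.
have cF n : ((c n)%:E * mu (F n) <= (1 / (2 ^ n.+1)%:R)%:E)%E.
  have Ffin : mu (F n) \is a fin_num by rewrite ge0_fin_numE.
  rewrite -(fineK Ffin) -EFinM lee_fin /c mulrAC ler_pdivrMr//.
  by rewrite ler_wpM2l ?(ltW (p0 n))// lerDr.
pose u n s : \bar R := (c n * \1_(F n) s)%:E.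
have u0 n s : (0 <= u n s)%E by rewrite lee_fin mulr_ge0// ltW.
have mu_ n : measurable_fun setT (u n).
  by apply/measurable_EFinP; apply: measurable_funM.
pose E s := (\sum_(n <oo) u n s)%E.
have E0 s : (0 <= E s)%E by apply: nneseries_ge0.
have E1 s : (E s <= 1%:E)%E.
  apply: le_trans (epsilon_trick0 xpredT ler01).
  apply: lee_nneseries => // n _; rewrite lee_fin.
  by apply: le_trans (c1 n); rewrite ler_piMr// ?ltW// indicE lern1 leq_b1.
have Efin s : E s \is a fin_num.
  by rewrite ge0_fin_numE// (le_lt_trans (E1 s))// ltry.
have mE : measurable_fun setT E.
  by apply: ge0_emeasurable_sum.
exists (fine \o E); last first.
  move=> s; rewrite /= fine_gt0// (le_lt_trans (E1 s)) ?ltry// andbT.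
  have : (\bigcup_i F i) s by rewrite -FT.
  move=> [n _ Fns]; apply: (@lt_le_trans _ _ (u n s)).
    by rewrite lte_fin mulr_gt0// indicE mem_set.
  apply: le_trans (nneseries_lim_ge n.+1 _) => //.
  by rewrite big_nat_recr//= leeDr// sume_ge0.
split=> [|s|].
- exact: measurableT_comp.
- exact: fine_ge0.
- under eq_integral do rewrite /= fineK//.
  rewrite integral_nneseries//.
  apply: (@le_lt_trans _ _ 1%:E); last exact: ltry.
  apply: le_trans (epsilon_trick0 xpredT ler01).
  apply: lee_nneseries => [n _ _|n _]; first exact: integral_ge0.
  apply: le_trans (cF n); under eq_integral do rewrite /u EFinM.
  rewrite ge0_integralZl//; last by rewrite lee_fin ltW.
    by rewrite integral_indic// setIT.
  exact/measurable_EFinP.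
Qed.

(** * The flow and its action on non-negative functions *)

Section nonsingular_flow.
Context (d : nat) (X : set 'rV[R]_d) (phi : 'rV[R]_d -> T -> T).
Context (omega : 'rV[R]_d -> T -> R).
Hypothesis XG : index_group X.
Hypothesis phi_flow : nonsingular_flow X mu phi.
Hypothesis omega_RN : is_RN_cocycle X mu phi omega.
Implicit Types x y : 'rV[R]_d.

Lemma index_groupN x : X x -> X (- x).
Proof.
by case: XG => -> // Xx i; rewrite mxE rpredN; exact: Xx.
Qed.

Lemma index_groupD x y : X x -> X y -> X (x + y).
Proof.
by case: XG => -> // Xx Xy i; rewrite mxE rpredD.
Qed.

Lemma flowD x y s : X x -> X y -> phi y (phi x s) = phi (x + y) s.
Proof. by move=> Xx Xy; have [_ -> //] := phi_flow. Qed.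

Lemma flowK x s : X x -> phi (- x) (phi x s) = s.
Proof.
move=> Xx; rewrite flowD ?subrr//; last exact: index_groupN.
by have [-> _ _ _] := phi_flow.
Qed.

Lemma flowNK x s : X x -> phi x (phi (- x) s) = s.
Proof. by move=> Xx; rewrite -{1}[x]opprK flowK//; exact: index_groupN. Qed.

(** Joint measurability is stated on tuples, so [phi x] is recovered as the section at the tuple of
    coordinates of [x]. *)
Lemma measurable_flow x : X x -> measurable_fun setT (phi x).
Proof.
move=> Xx; have [_ _ mphi _] := phi_flow.
pose t : d.-tuple R := [tuple x ord0 i | i < d].
have tx : row_of_tuple t = x.
  by apply/rowP => i; rewrite mxE tnth_mktuple.
rewrite (_ : phi x = (fun p : d.-tuple R * T => phi (row_of_tuple p.1) p.2) \o
    pair t); last by apply/funext => s /=; rewrite tx.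
apply: (measurable_comp _ _ mphi) => //.
- by apply: measurableX => //; exact: measurable_index_group.
- by move=> _ [s _ <-]; split => //=; rewrite tx.
Qed.

Lemma measurable_preimage_flow x A :
  X x -> measurable A -> measurable (phi x @^-1` A).
Proof.
move=> Xx mA; rewrite -[X in measurable X]setTI.
exact: measurable_flow.
Qed.

Lemma measurable_Uop x g : X x -> measurable_fun setT g ->
  measurable_fun setT (Uop phi omega x g).
Proof.
move=> Xx mg; have [mw _ _] := omega_RN _ Xx.
apply: measurable_funM => //.
by apply: measurableT_comp => //; exact: measurable_flow.
Qed.

Lemma Uop_ge0 x g : X x -> (forall s, 0 <= g s) ->
  forall s, 0 <= Uop phi omega x g s.
Proof.
by move=> Xx g0 s; have [_ w0 _] := omega_RN _ Xx; rewrite mulr_ge0.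
Qed.

(** Images under [phi x] are preimages under [phi (- x)], so [omega x] is the density of the
    pushforward of [mu] along [phi (- x)], and the claim is the corresponding change of
    variables. *)
Lemma integral_Uop x A g : X x -> measurable A ->
  measurable_fun setT g -> (forall s, 0 <= g s) ->
  (\int[mu]_(s in A) (Uop phi omega x g s)%:E =
   \int[mu]_(s in phi (- x) @^-1` A) (g s)%:E)%E.
Proof.
move=> Xx mA mg g0; have XNx := index_groupN _ Xx.
have [mw w0 wE] := omega_RN _ Xx.
have mh : measurable_fun setT (fun s => \1_A s * g (phi x s)).
  apply: measurable_funM => //.
  by apply: measurableT_comp => //; exact: measurable_flow.
have h0 s : 0 <= \1_A s * g (phi x s) by rewrite mulr_ge0.
transitivity (\int[mu]_s (omega x s * (\1_A s * g (phi x s)))%:E)%E.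
  rewrite integral_mkcond; apply: eq_integral => s _.
  by rewrite epatch_indic/= -EFinM /Uop mulrAC -mulrA.
transitivity (\int[mu]_s (\1_A (phi (- x) s) * g s)%:E)%E; last first.
  rewrite [RHS]integral_mkcond; apply: eq_integral => s _.
  by rewrite epatch_indic/= -EFinM mulrC.
transitivity (\int[pushforward mu (phi (- x))]_s (\1_A s * g (phi x s))%:E)%E;
  last first.
  rewrite (ge0_integral_pushforward (measurable_flow _ XNx))//.
  - by apply: eq_integral => s _ /=; rewrite flowNK.
  - exact/measurable_EFinP.
  - by move=> s _; rewrite lee_fin.
apply: ge0_integral_density => //; first exact: measurable_flow.
move=> mphiN B mB; rewrite -wE//; congr (mu _).
apply/seteqP; split=> [s /= Bs|_ [s Bs <-]/=]; last by rewrite flowK.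
by exists (phi (- x) s) => //; rewrite flowNK.
Qed.

(* [overlap mu phi omega x g] is convertible to [cross x g g]. *)
Definition cross x f g : \bar R :=
  (\int[mu]_s (Num.min (Uop phi omega x f s) (g s))%:E)%E.

(** Pulled back along [phi y], the set integrals of [U_(x - y) f] and [g] become those of [U_x f]
    and [U_y g]. The bound depends only on the difference [x - y], hence is small for widely
    separated points when [f = g] vanishes. *)
Lemma integral_min_Uop_le x y f g : X x -> X y ->
  measurable_fun setT f -> (forall s, 0 <= f s) ->
  measurable_fun setT g -> (forall s, 0 <= g s) ->
  (\int[mu]_s (Num.min (Uop phi omega x f s) (Uop phi omega y g s))%:E <=
   cross (x - y) f g)%E.
Proof.
move=> Xx Xy mf f0 mg g0; have XNy := index_groupN _ Xy.
have Xxy := index_groupD _ _ Xx XNy.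
apply: (integral_min_pullback _ _ _ _ (phi y)) => //;
  do ?[exact: measurable_Uop|exact: Uop_ge0|exact: measurable_flow].
- move=> A mA; rewrite !integral_Uop//; last exact: measurable_preimage_flow.
  congr (integral _ _ _); apply/funext => s.
  by rewrite /preimage/= flowD ?opprB ?[- x + y]addrC//; exact: index_groupN.
- move=> A mA; rewrite !integral_Uop//; last exact: measurable_preimage_flow.
  by congr (integral _ _ _); apply/funext => s; rewrite /preimage/= flowNK.
Qed.

(** The pullback along [phi y] of [U_x g] and [g]; commutativity of the group matches the set
    integrals of [U_x (U_y g)] with those of [U_x g]. *)
Lemma overlap_Uop_le x y g : X x -> X y ->
  measurable_fun setT g -> (forall s, 0 <= g s) ->
  (overlap mu phi omega x (Uop phi omega y g) <= overlap mu phi omega x g)%E.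
Proof.
move=> Xx Xy mg g0.
have XNy := index_groupN _ Xy; have XNx := index_groupN _ Xx.
apply: (integral_min_pullback _ _ _ _ (phi y)) => //;
  do ?[exact: measurable_Uop|exact: Uop_ge0|exact: measurable_flow].
- by apply: measurable_Uop => //; exact: measurable_Uop.
- by apply: Uop_ge0 => //; exact: Uop_ge0.
- move=> A mA; rewrite !integral_Uop//;
    do ?[exact: measurable_preimage_flow|exact: measurable_Uop|exact: Uop_ge0
        |apply: measurable_preimage_flow => //;
         exact: measurable_preimage_flow].
  congr (integral _ _ _); apply/funext => s; rewrite /preimage/=.
  rewrite !flowD//; last exact: index_groupD.
  by rewrite addrCA addNr addr0.
- move=> A mA; rewrite !integral_Uop//; last exact: measurable_preimage_flow.
  by congr (integral _ _ _); apply/funext => s; rewrite /preimage/= flowNK.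
Qed.

(** * Vanishing functions and their closure properties *)

Let U := Uop phi omega.
Let mU := measurable_Uop.
Let U0 := Uop_ge0.

Lemma integral_UopT x g :
  X x -> measurable_fun setT g -> (forall s, 0 <= g s) ->
  (\int[mu]_s (U x g s)%:E = \int[mu]_s (g s)%:E)%E.
Proof. by move=> Xx mg g0; rewrite integral_Uop// preimage_setT. Qed.

Definition vanishes g := forall e : R, 0 < e ->
  exists M : R, forall x, X x -> M < `|x| ->
    (overlap mu phi omega x g <= e%:E)%E.

(* If some U_x1 f /\ g has integral above e, subtracting it from g lowers the
   integral of g by e, while U_x f /\ U_x1 f is eventually negligible; hence the
   induction on the number k of such steps. *)
Lemma cross_eventually_le f g (e eta : R) (k : nat) :
  ge0_integrable f -> vanishes f -> 0 < e -> 0 < eta ->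
  ge0_integrable g -> (\int[mu]_s (g s)%:E <= (k%:R * e)%:E)%E ->
  exists M : R, forall x, X x -> M < `|x| ->
    (cross x f g <= (e + k%:R * eta)%:E)%E.
Proof.
move=> [mf f0 foo] vf e0 eta0.
elim: k g => [|k IH] g gi gk; have [mg g0 goo] := gi.
  exists 0 => x Xx _; rewrite mul0r addr0.
  apply: (@le_trans _ _ (\int[mu]_s (g s)%:E)%E); last first.
    by apply: le_trans gk _; rewrite mul0r lee_fin ltW.
  apply: ge0_EFin_le_integral => // [|s|s].
  - by apply: measurable_minr => //; exact: mU.
  - by rewrite le_min g0 andbT; exact: U0.
  - by rewrite ge_min lexx orbT.
have [[x1 [Xx1 ex1]]|small] := pselect (exists x1, X x1 /\
    (e%:E < cross x1 f g)%E); last first.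
  exists 0 => x Xx _; apply: (@le_trans _ _ e%:E).
    by rewrite leNgt; apply/negP => ex; apply: small; exists x.
  by rewrite lee_fin lerDl mulr_ge0// ltW.
pose m s := Num.min (U x1 f s) (g s).
have mm : measurable_fun setT m.
  by apply: measurable_minr => //; exact: mU.
have m0 s : 0 <= m s by rewrite le_min g0 andbT; exact: U0.
have mg' s : m s <= g s by rewrite ge_min lexx orbT.
have ri := ge0_integrableB _ _ gi mm m0 mg'.
have [mr r0 _] := ri.
have mi := ge0_integrable_le _ _ gi mm m0 mg'.
have rk : (\int[mu]_s (g s - m s)%:E <= (k%:R * e)%:E)%E.
  have : (\int[mu]_s (g s - m s)%:E + \int[mu]_s (m s)%:E <=
      (k.+1%:R * e)%:E)%E.
    rewrite -ge0_EFin_integralD//.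
    by under eq_integral do rewrite subrK.
  have := ge0_integrable_fineK _ ri.
  have := ge0_integrable_fineK _ mi.
  move: ex1; rewrite /cross -/m.
  case: (\int[mu]_s (m s)%:E)%E => // b.
  case: (\int[mu]_s (g s - m s)%:E)%E => // a.
  rewrite lte_fin -EFinD !lee_fin => eb _ _.
  by rewrite -natr1 mulrDl mul1r; lra.
have [M1 M1P] := IH _ ri rk.
have [M2 M2P] := vf _ eta0.
(* Adding the norm of [x1] puts [x - x1] beyond [M2], where the overlap of [f] is at most [eta]. *)
exists (Num.max M1 (M2 + `|x1|)) => x Xx.
rewrite gt_max => /andP[M1x M2x].
have -> : e + k.+1%:R * eta = (e + k%:R * eta) + eta by rewrite -natr1; ring.
have Xxx1 : X (x - x1).
  by apply: index_groupD => //; exact: index_groupN.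
have M2x1 : M2 < `|x - x1|.
  by apply: lt_le_trans (lerB_dist _ _); rewrite ltrBrDr.
(* By [min_subr_le] the integral splits in two: the induction hypothesis bounds the part with
   [g - m], and the minimum of [U_x f] and [U_x1 f] is controlled by the overlap at [x - x1]. *)
rewrite EFinD; apply: le_trans (leeD (M1P _ Xx M1x) (M2P _ Xxx1 M2x1)).
have := integral_min_Uop_le x x1 f f Xx Xx1 mf f0 mf f0.
move=> /(leeD2l (cross x f (fun s => g s - m s))).
apply: le_trans; rewrite -ge0_EFin_integralD//.
- apply: ge0_EFin_le_integral => // [|s||s].
  + by apply: measurable_minr => //; exact: mU.
  + by rewrite le_min g0 andbT; exact: U0.
  + by apply: measurable_funD; apply: measurable_minr => //; exact: mU.
  + by apply: min_subr_le => //; exact: U0.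
- by apply: measurable_minr => //; exact: mU.
- by move=> s; rewrite le_min r0 andbT; exact: U0.
- by apply: measurable_minr => //; exact: mU.
- by move=> s; rewrite le_min !U0.
Qed.

Lemma cross_vanishes f g (e : R) :
  ge0_integrable f -> vanishes f -> ge0_integrable g -> 0 < e ->
  exists M : R, forall x, X x -> M < `|x| ->
    (cross x f g <= e%:E)%E.
Proof.
move=> fi vf gi e0.
have gfin := ge0_integrable_fineK _ gi.
have e20 : 0 < e / 2 by rewrite divr_gt0.
(* At most [k] steps of size [e / 2] fit below [g]. The successor makes [k] positive, so
   [eta = e / 2 / k] is defined and [e / 2 + k * eta = e]. *)
pose k := (Num.truncn (fine (\int[mu]_s (g s)%:E)%E / (e / 2))).+1.
have k0 : 0 < k%:R :> R by rewrite ltr0n.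
have eta0 : 0 < e / 2 / k%:R by rewrite divr_gt0.
have gk : (\int[mu]_s (g s)%:E <= (k%:R * (e / 2))%:E)%E.
  rewrite -(fineK gfin) lee_fin -ler_pdivrMr//.
  exact/ltW/truncnS_gt.
have [M MP] := cross_eventually_le _ _ _ _ _ fi vf e20 eta0 gi gk.
exists M => x Xx Mx; apply: le_trans (MP x Xx Mx) _.
by rewrite lee_fin [k%:R * _]mulrC divfK ?gt_eqF// -splitr.
Qed.

Lemma vanishes_le f g : ge0_integrable f -> ge0_integrable g ->
  (forall s, f s <= g s) -> vanishes g -> vanishes f.
Proof.
move=> [mf f0 _] [mg g0 _] fg vg e e0; have [M MP] := vg e e0.
exists M => x Xx Mx; apply: le_trans (MP x Xx Mx).
apply: ge0_EFin_le_integral => // [|s||s].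
- by apply: measurable_minr => //; exact: mU.
- by rewrite le_min f0 andbT; exact: U0.
- by apply: measurable_minr => //; exact: mU.
- rewrite le_min !ge_min fg orbT andbT ler_wpM2l//.
  by have [_ ->] := omega_RN _ Xx.
Qed.

Lemma vanishes0 : vanishes (fun=> 0).
Proof.
move=> e e0; exists 0 => x Xx _; rewrite /overlap integral0_eq ?lee_fin ?ltW//.
by move=> s _; rewrite /Uop mulr0 minxx.
Qed.

(** The minimum of two sums is at most the sum of the four pairwise minima; the mixed ones are small
    by [cross_vanishes]. *)
Lemma vanishesD f g : ge0_integrable f -> ge0_integrable g ->
  vanishes f -> vanishes g -> vanishes (fun s => f s + g s).
Proof.
move=> fi gi vf vg e e0; have [mf f0 _] := fi; have [mg g0 _] := gi.
have e40 : 0 < e / 4 by rewrite divr_gt0.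
have cv := cross_vanishes.
have [M1 M1P] := cv f f _ fi vf fi e40.
have [M2 M2P] := cv f g _ fi vf gi e40.
have [M3 M3P] := cv g f _ gi vg fi e40.
have [M4 M4P] := cv g g _ gi vg gi e40.
exists (Num.max (Num.max M1 M2) (Num.max M3 M4)) => x Xx.
rewrite !gt_max => /andP[/andP[M1x M2x] /andP[M3x M4x]].
have -> : e = e / 4 + e / 4 + (e / 4 + e / 4) by field.
rewrite !EFinD; apply: le_trans (leeD (leeD (M1P _ Xx M1x) (M2P _ Xx M2x))
  (leeD (M3P _ Xx M3x) (M4P _ Xx M4x))).
have mc h1 h2 : measurable_fun setT h1 -> measurable_fun setT h2 ->
    measurable_fun setT (fun s => Num.min (U x h1 s) (h2 s)).
  by move=> m1 m2; apply: measurable_minr => //; exact: mU.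
have c0 h1 h2 : (forall s, 0 <= h1 s) -> (forall s, 0 <= h2 s) ->
    forall s, 0 <= Num.min (U x h1 s) (h2 s).
  by move=> h10 h20 s; rewrite le_min h20 andbT; exact: U0.
rewrite -!ge0_EFin_integralD//;
  do ?[exact: mc|exact: c0|by move=> s; rewrite addr_ge0// c0
      |by apply: measurable_funD; exact: mc].
apply: ge0_EFin_le_integral => // [|s||s].
- by apply: mc => //; exact: measurable_funD.
- have fg0 t : 0 <= f t + g t by rewrite addr_ge0.
  exact: (c0 _ _ fg0 fg0).
- by apply: measurable_funD; apply: measurable_funD; exact: mc.
- rewrite -/U; have -> : U x (fun s => f s + g s) s = U x f s + U x g s.
    exact: mulrDr.
  by apply: min_addDD_le => //; exact: U0.
Qed.

Lemma vanishes_max f g : ge0_integrable f -> ge0_integrable g ->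
  vanishes f -> vanishes g -> vanishes (fun s => Num.max (f s) (g s)).
Proof.
move=> fi gi vf vg.
apply: (vanishes_le _ (fun s => f s + g s)).
- exact: ge0_integrable_max.
- exact: ge0_integrableD.
- have [_ f0 _] := fi; have [_ g0 _] := gi => s.
  by rewrite ge_max lerDl lerDr f0 g0.
- exact: vanishesD.
Qed.

(** Truncation at these multiples will exhaust any function supported where [f] is positive. *)
Lemma vanishesMn f k : ge0_integrable f -> vanishes f ->
  ge0_integrable (fun s => f s *+ k) /\ vanishes (fun s => f s *+ k).
Proof.
move=> fi vf; elim: k => [|k [IHi IHv]].
  split; last exact: vanishes0.
  by split=> //; rewrite integral0_eq// ltry.
rewrite (_ : (fun s => f s *+ k.+1) = (fun s => f s + f s *+ k)); last first.
  by apply/funext => s; rewrite mulrS.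
by split; [exact: ge0_integrableD|exact: vanishesD].
Qed.

Lemma vanishes_Uop y f : X y -> ge0_integrable f -> vanishes f ->
  ge0_integrable (U y f) /\ vanishes (U y f).
Proof.
move=> Xy [mf f0 foo] vf; split.
  split; [exact: mU|exact: U0|].
  by rewrite integral_UopT.
move=> e e0; have [M MP] := vf e e0; exists M => x Xx Mx.
by apply: le_trans (MP _ Xx Mx); exact: overlap_Uop_le.
Qed.

(** Write [g] as [G n] plus a remainder [r] of integral at most [e / 4]. As [U_x] preserves
    integrals, [r] adds at most [e / 2] to the overlap, uniformly in [x]. *)
Lemma vanishes_lim (G : nat -> T -> R) g :
  (forall n, ge0_integrable (G n)) -> (forall n, vanishes (G n)) ->
  (forall s m n, (m <= n)%N -> G m s <= G n s) ->
  (forall s, G ^~ s @ \oo --> g s) -> ge0_integrable g -> vanishes g.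
Proof.
move=> Gi vG ndG Gg gi e e0; have [mg g0 _] := gi.
have e40 : 0 < e / 4 by rewrite divr_gt0.
have mG n : measurable_fun setT (G n) by have [] := Gi n.
have G0 n s : 0 <= G n s by have [] := Gi n.
have [n gGn] := ge0_integral_nondecreasing_lim _ _ _ mG G0 ndG Gg gi e40.
have Gng s : G n s <= g s.
  rewrite -(cvg_lim _ (Gg s))//; apply: nondecreasing_cvgn_le.
    by move=> p q pq; exact: ndG.
  exact: cvgP (Gg s).
pose r s := g s - G n s.
have [mr r0 roo] : ge0_integrable r by exact: ge0_integrableB.
have re : (\int[mu]_s (r s)%:E <= (e / 4)%:E)%E.
  have Gnfin := ge0_integrable_fineK _ (Gi n).
  move: gGn; have -> : (\int[mu]_s (g s)%:E =
      \int[mu]_s (G n s)%:E + \int[mu]_s (r s)%:E)%E.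
    rewrite -ge0_EFin_integralD//; apply: eq_integral => s _.
    by rewrite /r addrC subrK.
  by rewrite leeD2lE.
have [M MP] := vG n _ e40; exists M => x Xx Mx.
have Ur : (\int[mu]_s (U x r s)%:E <= (e / 4)%:E)%E.
  by rewrite integral_UopT.
apply: (@le_trans _ _ (e / 4 + (e / 4 + e / 4))%:E); last first.
  by rewrite lee_fin; lra.
rewrite !EFinD; apply: le_trans (leeD (MP _ Xx Mx) (leeD Ur re)).
have mUr : measurable_fun setT (U x r) by exact: mU.
have Ur0 : forall s, 0 <= U x r s by exact: U0.
have mm h : measurable_fun setT h ->
    measurable_fun setT (fun s => Num.min (U x h s) (h s)).
  by move=> mh; apply: measurable_minr => //; exact: mU.
have m0 h : (forall s, 0 <= h s) -> forall s, 0 <= Num.min (U x h s) (h s).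
  by move=> h0 s; rewrite le_min h0 andbT; exact: U0.
rewrite -!ge0_EFin_integralD//;
  do ?[exact: mm|exact: m0|by move=> s; rewrite addr_ge0
      |exact: measurable_funD].
apply: ge0_EFin_le_integral => // [|||s].
- exact: mm.
- exact: m0.
- by apply: measurable_funD; [exact: mm|exact: measurable_funD].
- rewrite -/U; have -> : U x g s = U x (G n) s + U x r s.
    by rewrite /U /Uop /r -mulrDr addrC subrK.
  have {1}-> : g s = G n s + r s by rewrite /r addrC subrK.
  exact: min_addrl_le.
Qed.

(** * A maximal vanishing function *)

(** The supremum [S] of the integrals of vanishing functions below [f] is finite, and it is attained
    by the limit of an increasing maximizing sequence. *)
Lemma exists_max_vanishes f : ge0_integrable f ->
  exists g, [/\ ge0_integrable g, vanishes g
    & forall h, ge0_integrable h -> vanishes h -> (forall s, h s <= f s) ->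
      mu [set s | g s < h s] = 0%E].
Proof.
move=> fi; have [mf f0 foo] := fi.
pose W := [set g | [/\ ge0_integrable g, vanishes g & forall s, g s <= f s]].
pose I g := (\int[mu]_s (g s)%:E)%E.
pose S := ereal_sup (I @` W).
have W0 : W (fun=> 0).
  split=> //; last exact: vanishes0.
  by apply: (ge0_integrable_le _ _ fi).
have S0 : (0 <= S)%E.
  by apply: ereal_sup_ge; exists (I (fun=> 0)); [exists (fun=> 0)|
    rewrite /I integral0_eq].
have Soo : (S < +oo)%E.
  apply: le_lt_trans foo; apply: ge_ereal_sup => _ [g [[mg g0 _] _ gf] <-].
  exact: ge0_EFin_le_integral.
have Sfin : S \is a fin_num by rewrite ge0_fin_numE.
have /choice[a aP] (n : nat) :
    exists g, W g /\ (S - (n.+1%:R^-1)%:E < I g)%E.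
  have n0 : 0 < n.+1%:R^-1 :> R by rewrite invr_gt0 ltr0n.
  by have [_ [g Wg <-] Sg] := ub_ereal_sup_adherent n0 Sfin; exists g.
(* Running maxima make the maximizing sequence increasing without leaving [W]. *)
pose G := fix G n :=
  if n is k.+1 then (fun s => Num.max (G k s) (a k.+1 s)) else a 0%N.
have WG n : W (G n).
  elim: n => [|n [Gi vG Gf]]; first by case: (aP 0%N).
  have [[ai va af] _] := aP n.+1.
  split; [exact: ge0_integrable_max|exact: vanishes_max|].
  by move=> s /=; rewrite ge_max Gf af.
have aG n s : a n s <= G n s by case: n => [//|n]; rewrite /= le_max lexx orbT.
have ndG s : nondecreasing_seq (G ^~ s).
  by apply/nondecreasing_seqP => n /=; rewrite le_max lexx.
have cvG s : cvgn (G ^~ s).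
  apply: nondecreasing_is_cvgn => //; exists (f s) => _ [n _ <-].
  by have [_ _] := WG n.
pose g s := limn (G ^~ s).
have Gg s n : G n s <= g s by exact: nondecreasing_cvgn_le.
have gf s : g s <= f s.
  by apply: limr_le => //; apply: nearW => n; have [_ _] := WG n.
have mg : measurable_fun setT g.
  apply: (@measurable_fun_cvg _ _ _ _ G) => [n|s _]; last exact: cvG.
  by have [[]] := WG n.
have g0 s : 0 <= g s.
  by apply: le_trans (Gg s 0%N); have [[]] := WG 0%N.
have gi : ge0_integrable g by exact: (ge0_integrable_le _ f).
have vg : vanishes g.
  by apply: (vanishes_lim G) => // n; have [] := WG n.
have Sg : (S <= I g)%E.
  apply/lee_addgt0Pr => e e0.
  have [n] := ltr_add_invr e0; rewrite add0r => ne.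
  have [_ /ltW] := aP n; rewrite leeBlDr// => /le_trans; apply.
  apply: leeD; last by rewrite lee_fin ltW.
  have [[[ma a0 _] _ _] _] := aP n; apply: ge0_EFin_le_integral => // s.
  exact: le_trans (aG n s) (Gg s n).
exists g; split=> // h hi vh hf; have [mh h0 _] := hi.
(* Since [k] is again in [W], its integral cannot exceed that of [g]; hence [k - g] is null, and it
   is non-zero exactly where [g < h]. *)
pose k s := Num.max (g s) (h s).
have ki : ge0_integrable k by exact: ge0_integrable_max.
have [mk k0 _] := ki.
have kS : (I k <= S)%E.
  apply: ereal_sup_ubound; exists k => //; split=> //.
    exact: vanishes_max.
  by move=> s; rewrite ge_max gf hf.
have gk s : g s <= k s by rewrite le_max lexx.
have [mr r0 _] := ge0_integrableB _ _ ki mg g0 gk.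
have rle : (\int[mu]_s (k s - g s)%:E <= 0)%E.
  have gfin := ge0_integrable_fineK _ gi.
  have : (I k <= I g)%E by exact: le_trans kS Sg.
  have -> : (I k = I g + \int[mu]_s (k s - g s)%:E)%E.
    rewrite /I -ge0_EFin_integralD//; apply: eq_integral => s _.
    by rewrite addrC subrK.
  by rewrite -[leRHS]adde0 leeD2lE.
rewrite -(ge0_integral_eq0 _ mr r0 rle); congr (mu _).
apply/seteqP; split=> s /=; rewrite subr_eq0 /k.
  by move=> gh; rewrite max_r ?ltW// gt_eqF.
by case: (ltP (g s) (h s)) => // _; rewrite eqxx.
Qed.

(** * The support of the vanishing functions and its invariance *)

Lemma nonneg_L1_onP N g : nonneg_L1_on mu N g <->
  ge0_integrable g /\ (forall s, ~ N s -> g s = 0).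
Proof.
split=> [[mg gi g0 gN]|[[mg g0 goo] gN]].
  by split=> //; split=> //; exact/(ge0_integrable_EFinP g mg g0).
by split=> //; exact/(ge0_integrable_EFinP g mg g0).
Qed.

(** A strictly positive integrable function cut off to the intersection is supported on both sets
    and non-zero exactly there; unless the intersection is null, the two properties contradict each
    other on it. *)
Lemma vanishing_positive_disjoint A B : sigma_finite setT mu ->
  measurable A -> measurable B ->
  vanishing_part X mu phi omega A -> positive_part X mu phi omega B ->
  mu (A `&` B) = 0%E.
Proof.
move=> /exists_positive_integrable[f fi fgt0] mA mB vA pB.
have [mf f0 _] := fi; have mAB := measurableI _ _ mA mB.
pose h s := f s * \1_(A `&` B) s.
have hi : ge0_integrable h.
  apply: (ge0_integrable_le _ _ fi) => [|s|s].
  - exact: measurable_funM.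
  - by rewrite mulr_ge0.
  - by rewrite ler_piMr// indicE lern1 leq_b1.
have hAB s : ~ (A `&` B) s -> h s = 0.
  by move=> nABs; rewrite /h indicE memNset// mulr0.
have hA : nonneg_L1_on mu A h.
  by apply/nonneg_L1_onP; split=> // s nAs; apply: hAB => -[].
have hB : nonneg_L1_on mu B h.
  by apply/nonneg_L1_onP; split=> // s nBs; apply: hAB => -[].
have hE : [set s | h s != 0] = A `&` B.
  apply/seteqP; split=> s /=.
    by move=> /eqP hs; apply: contrapT => /hAB.
  by move=> ABs; rewrite /h indicE mem_set// mulr1 gt_eqF.
apply: contrapT; rewrite -hE => muh.
have [e e0 eP] := pB _ hB muh.
have [M MP] := vA _ hA _ e0.
have [x [Xx Mx]] := eP M.
by rewrite ltNge MP.
Qed.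

(** The image under [phi x] of the zero set of [omega x] is null by the integral formula. It is a
    preimage under [phi (- x)], so non-singularity applies. *)
Lemma omega_ae_gt0 x : X x -> mu [set s | omega x s <= 0] = 0%E.
Proof.
move=> Xx; have [mw w0 wE] := omega_RN _ Xx.
have XNx := index_groupN _ Xx.
have mZ : measurable [set s | omega x s <= 0].
  by apply: measurable_le_set => //; exact: measurable_cst.
have [_ _ _ nsing] := phi_flow.
apply/(nsing (- x) _ XNx mZ).
rewrite (_ : _ @^-1` _ = phi x @` [set s | omega x s <= 0]).
  rewrite wE// integral0_eq// => s /= ws; congr (_%:E).
  by apply/eqP; rewrite eq_le ws w0.
apply/seteqP; split=> [s /= ws|_ [s ws <-]/=].
  by exists (phi (- x) s) => //; rewrite flowNK.
by rewrite flowK.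
Qed.

(** Take [g] maximal below a strictly positive [f], and [N] where [g] is positive. A function [u]
    supported on [N] is the increasing limit of the truncations [min u (n g)], hence vanishes. *)
Lemma exists_vanishing_support : sigma_finite setT mu ->
  exists N : set T, [/\ measurable N, vanishing_part X mu phi omega N,
    (exists2 g, ge0_integrable g /\ vanishes g
      & N = [set s | 0 < g s])
    & forall h, ge0_integrable h -> vanishes h ->
      mu ([set s | h s != 0] `\` N) = 0%E].
Proof.
move=> /exists_positive_integrable[f fi fgt0].
have [g [gi vg gmax]] := exists_max_vanishes f fi.
have [mf f0 foo] := fi; have [mg g0 goo] := gi.
exists [set s | 0 < g s]; split.
- by apply: measurable_lt_set => //; exact: measurable_cst.
- move=> u /nonneg_L1_onP[ui uN]; have [mu_ u0 uoo] := ui.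
  apply: (vanishes_lim
    (fun n s => Num.min (u s) (g s *+ n))) => //.
  + move=> n; have [[mgn gn0 _] _] := vanishesMn g n gi vg.
    apply: (ge0_integrable_le _ _ ui) => [|s|s].
    * exact: measurable_minr.
    * by rewrite le_min u0 gn0.
    * by rewrite ge_min lexx.
  + move=> n; have [gni vgn] := vanishesMn g n gi vg.
    have [mgn gn0 _] := gni.
    apply: (vanishes_le _
      (fun s => g s *+ n)) => // [|s]; last by rewrite ge_min lexx orbT.
    apply: (ge0_integrable_le _ _ ui) => [|s|s].
    * exact: measurable_minr.
    * by rewrite le_min u0 gn0.
    * by rewrite ge_min lexx.
  + move=> s m n mn; rewrite le_min !ge_min lexx/=.
    by rewrite ler_wpMn2l// orbT.
  + move=> s; have [gs0|gs0] := ltP 0 (g s); last first.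
      rewrite uN; last by apply/negP; rewrite -leNgt.
      rewrite (_ : (fun _ => _) = cst 0); first exact: cvg_cst.
      apply/funext => n; rewrite min_l// mulrn_wge0//.
    (* Once [n] is above [u s / g s], the truncation is constantly [u s]. *)
    apply: cvg_near_cst; exists (Num.truncn (u s / g s)).+1 => // n /= un.
    rewrite min_l// -mulr_natl -ler_pdivrMr//.
    by apply: ltW; apply: lt_le_trans (truncnS_gt _) _; rewrite ler_nat.
- by exists g.
- move=> h hi vh; have [mh h0 hoo] := hi.
  (* Truncating at [f] makes [h] comparable with the maximal [g]. As [f] is positive, [k] is
     positive wherever [h] is, so [g < k] at those points outside [N]. *)
  pose k s := Num.min (h s) (f s).
  have mk : measurable_fun setT k by exact: measurable_minr.
  have k0 s : 0 <= k s by rewrite le_min h0 f0.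
  have kh s : k s <= h s by rewrite ge_min lexx.
  have ki : ge0_integrable k by exact: (ge0_integrable_le _ _ hi).
  have vk : vanishes k.
    exact: (vanishes_le _ h).
  have kf s : k s <= f s by rewrite ge_min lexx orbT.
  have := gmax k ki vk kf => gk0.
  apply: (subset_measure0 _ _ _ gk0) => //.
  + apply: measurableD.
      rewrite (_ : mkset _ = [set s | 0 < h s]).
        by apply: measurable_lt_set => //; exact: measurable_cst.
      by apply/funext => s; rewrite /= lt0r h0 andbT.
    by apply: measurable_lt_set => //; exact: measurable_cst.
  + exact: measurable_lt_set.
  + move=> s /= [hs /negP]; rewrite -leNgt => gs.
    by apply: le_lt_trans gs _; rewrite lt_min fgt0 lt0r hs h0.
Qed.

(** The function [U_x g] vanishes, so it is null outside [N]; on the preimage of [N] it is positive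
    except where [omega x] is zero, a null set. *)
Lemma vanishing_support_preimage N x : X x -> measurable N ->
  (exists2 g, ge0_integrable g /\ vanishes g
    & N = [set s | 0 < g s]) ->
  (forall h, ge0_integrable h -> vanishes h ->
    mu ([set s | h s != 0] `\` N) = 0%E) ->
  mu (phi x @^-1` N `\` N) = 0%E.
Proof.
move=> Xx mN [g [gi vg] NE] Nmax.
have [mw w0 _] := omega_RN _ Xx.
have [ui vu] := vanishes_Uop x g Xx gi vg.
have mpre := measurable_preimage_flow.
have [mUg _ _] := ui.
have mUg0 : measurable [set s | Uop phi omega x g s != 0].
  rewrite -[X in measurable X]setTI.
  have mE : measurable_fun setT (EFin \o Uop phi omega x g).
    exact/measurable_EFinP.
  by have := emeasurable_neq measurableT mE 0%E.
have mZ : measurable [set s | omega x s <= 0].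
  by apply: measurable_le_set => //; exact: measurable_cst.
have mUN := measurableD mUg0 mN.
pose Z := [set s | omega x s <= 0].
have UZ0 : mu (([set s | Uop phi omega x g s != 0] `\` N) `|` Z) = 0%E.
  by rewrite measureU0//; [exact: Nmax|exact: omega_ae_gt0].
apply: (subset_measure0 _ _ _ UZ0) => //.
- by apply: measurableD => //; exact: mpre.
- exact: measurableU.
move=> s [Ns nNs]; have [ws|ws] := leP (omega x s) 0; first by right.
left; split=> //=; rewrite /Uop mulf_neq0// ?gt_eqF//.
by move: Ns; rewrite NE.
Qed.

(** The missing difference is the preimage under [phi x] of the given one at [- x], so it is null by
    non-singularity. *)
Lemma flow_invariant_of_preimage N : measurable N ->
  (forall x, X x -> mu (phi x @^-1` N `\` N) = 0%E) ->
  forall x, X x -> mu (symdiff (phi x @^-1` N) N) = 0%E.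
Proof.
move=> mN Npre x Xx; have XNx := index_groupN _ Xx.
have mpre := measurable_preimage_flow.
have [_ _ _ nsing] := phi_flow.
have mD y : X y -> measurable (phi y @^-1` N `\` N).
  by move=> Xy; apply: measurableD => //; exact: mpre.
have mD' : measurable (N `\` phi x @^-1` N).
  by apply: measurableD => //; exact: mpre.
have D'0 : mu (N `\` phi x @^-1` N) = 0%E.
  have /(nsing x _ Xx (mD _ XNx)) := Npre _ XNx.
  by congr (mu _ = _); apply/seteqP; split=> s [] /=; rewrite flowK.
by rewrite measureU0//; [exact: Npre|exact: mD].
Qed.

End nonsingular_flow.
End measure.

(** * The decomposition and its uniqueness *)

Arguments vanishing_positive_disjoint {R dT T mu d X phi omega}.
Arguments exists_vanishing_support {R dT T mu d X phi omega}.
Arguments vanishing_support_preimage {R dT T mu d X phi omega}.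
Arguments flow_invariant_of_preimage {R dT T mu d X phi}.

Theorem theorem5p3 (R : realType) (d : nat) (X : set 'rV[R]_d)
    (dT : measure_display) (T : measurableType dT)
    (mu : {measure set T -> \bar R}) (phi : 'rV[R]_d -> T -> T)
    (omega : 'rV[R]_d -> T -> R) :
  index_group X ->
  sigma_finite [set: T] mu ->
  nonsingular_flow X mu phi ->
  is_RN_cocycle X mu phi omega ->
  exists N0 Np : set T,
    [/\ is_decomposition N0 Np,
        (forall x, X x -> mu (symdiff (phi x @^-1` N0) N0) = 0%E /\
                          mu (symdiff (phi x @^-1` Np) Np) = 0%E),
        vanishing_part X mu phi omega N0,
        positive_part X mu phi omega Np
      & (forall M0 Mp : set T, is_decomposition M0 Mp ->
           vanishing_part X mu phi omega M0 ->
           positive_part X mu phi omega Mp ->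
           mu (symdiff M0 N0) = 0%E /\ mu (symdiff Mp Np) = 0%E)].
Proof.
move=> XG sf phi_flow omega_RN.
have [N [mN vN Ng Nmax]] :=
  exists_vanishing_support XG phi_flow omega_RN sf.
have mCN := measurableC mN.
have Ninv : forall x, X x -> mu (symdiff (phi x @^-1` N) N) = 0%E.
  apply: (flow_invariant_of_preimage XG phi_flow) => // x Xx.
  exact: (vanishing_support_preimage XG phi_flow omega_RN).
have pN : positive_part X mu phi omega (~` N).
  move=> h /nonneg_L1_onP[hi hN] muh.
  (* A vanishing [h] supported off [N] would be null by [Nmax]. The level [e] at which vanishing
     fails then serves as [delta]. *)
  have /existsNP[e /not_implyP[e0 /forallNP eP]] :
      ~ vanishes _ _ _ mu _ X phi omega h.
    move=> vh; apply: muh; rewrite -(Nmax _ hi vh); congr (mu _).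
    apply/seteqP; split=> [s /= hs|s []//]; split=> // Ns.
    by move/eqP: hs; apply; exact: hN.
  exists e => // M.
  have /existsNP[x /not_implyP[Xx /not_implyP[Mx ex]]] := eP M.
  by exists x; split=> //; rewrite ltNge; apply/negP.
exists N, (~` N); split=> //.
- by split=> //; [exact: setICr|exact: setUv].
- by move=> x Xx; rewrite preimage_setC symdiff_setC; split; exact: Ninv.
- move=> M0 Mp MD vM pM; have [mM0 mMp _ _] := MD.
  have MpE := is_decompositionC _ _ _ _ MD.
  (* Each difference is the intersection of the vanishing part of one decomposition with the
     positive part of the other. *)
  have MN : mu (M0 `\` N) = 0%E.
    exact: (vanishing_positive_disjoint _ _ sf mM0 mCN vM pN).
  have NM : mu (N `\` M0) = 0%E.
    rewrite setDE -MpE.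
    exact: (vanishing_positive_disjoint _ _ sf mN mMp vN pM).
  suff : mu (symdiff M0 N) = 0%E by rewrite MpE symdiff_setC.
  by rewrite measureU0//; exact: measurableD.
Qed.
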